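(* Let $m,d,r\ge 1$ be integers and let $F:\mathbb{R}^{m\times d}\to\mathbb{R}$. For $B\in\mathbb{R}^{m\times r}$ define $\phi_B:\mathbb{R}^{r\times d}\to\mathbb{R}$ by $\phi_B(A)=F(BA)$. Assume that for every fixed $B\in\mathbb{R}^{m\times r}$: (i) $\phi_B$ is differentiable and there is a constant $L_A>0$ (possibly depending on $B$) such that $\lVert\nabla_A\phi_B(A_1)-\nabla_A\phi_B(A_2)\rVert_F\le L_A\lVert A_1-A_2\rVert_F$ for all $A_1,A_2\in\mathbb{R}^{r\times d}$; (ii) there is $\phi_B^{\inf}>-\infty$ such that $\phi_B(A)\ge\phi_B^{\inf}$ for all $A\in\mathbb{R}^{r\times d}$. Fix $B\in\mathbb{R}^{m\times r}$, with corresponding $L_A$ and $\phi_B^{\inf}$, a step size $0<\eta\le 1/L_A$, a constant $\sigma\ge 0$, and a deterministic initial point $A_0\in\mathbb{R}^{r\times d}$. Let $A_{t+1}=A_t-\eta G_t$ for $t\ge 0$, where the random matrices $G_t\in\mathbb{R}^{r\times d}$ satisfy, for every $t\ge 0$, $$\mathbb{E}[G_t\mid A_t]=\nabla_A\phi_B(A_t),\qquad \mathbb{E}\big[\lVert G_t-\nabla_A\phi_B(A_t)\rVert_F^2\mid A_t\big]\le\sigma^2.$$ Then for every integer $T\ge 1$, $$\min_{0\le t<T}\mathbb{E}\big[\lVert\nabla_A\phi_B(A_t)\rVert_F^2\big]\le\frac{2\big(\phi_B(A_0)-\phi_B^{\inf}\big)}{\eta T}+L_A\eta\sigma^2.$$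 In particular, choosing $\eta=\Theta(T^{-1/2})$ subject to $\eta\le 1/L_A$ yields an $O(T^{-1/2})$ rate: for all constants $0<c_1\le c_2$ there is a constant $C$, independent of $T$, such that for every $T\ge 1$, if the iteration from $A_0$ is run with a constant step size $\eta$ satisfying $c_1T^{-1/2}\le\eta\le c_2T^{-1/2}$ and $\eta\le 1/L_A$, then $\min_{0\le t<T}\mathbb{E}[\lVert\nabla_A\phi_B(A_t)\rVert_F^2]\le C\,T^{-1/2}$.
   Context: $\lVert\cdot\rVert_F$ is the Frobenius norm, and $\nabla_A\phi_B(A)\in\mathbb{R}^{r\times d}$ is the gradient of $\phi_B$ with respect to the Frobenius inner product. *)

(* Defs.v *)
From mathcomp Require Import all_boot all_order all_algebra.
From mathcomp Require Import all_classical all_reals all_analysis.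

Set Implicit Arguments.
Unset Strict Implicit.
Unset Printing Implicit Defensive.

Import Order.TTheory GRing.Theory Num.Theory.
Import numFieldNormedType.Exports.

Local Open Scope classical_set_scope.
Local Open Scope ring_scope.

Section Frobenius.
Context {R : realType} {r d : nat}.

Definition frob_inner (U V : 'M[R]_(r, d)) : R := \tr (U^T *m V).

Definition frob_norm (U : 'M[R]_(r, d)) : R := Num.sqrt (frob_inner U U).

Lemma frob_innerE U V : frob_inner U V = \sum_i \sum_j U i j * V i j.
Proof.
rewrite /frob_inner /mxtrace exchange_big /=; apply: eq_bigr => j _.
by rewrite mxE; apply: eq_bigr => i _; rewrite mxE.
Qed.

(* The Riesz representative of the differential of [f] at [A] for the Frobenius
   inner product. The library norms ['M[R]_(r, d)] by the largest absolute value
   of an entry; that norm is equivalent to [frob_norm], so [differentiable] and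
   ['d] are the usual ones. Where [f] is not differentiable the value is junk. *)
Definition gradient (f : 'M[R]_(r, d) -> R) (A : 'M[R]_(r, d)) : 'M[R]_(r, d) :=
  xget 0 [set g | forall H : 'M[R]_(r, d), 'd f A H = frob_inner g H].

Lemma gradientE f A :
  gradient f A = \matrix_(i, j) 'd f A (delta_mx i j : 'M[R]_(r, d)).
Proof.
have inner_delta g i j : frob_inner g (delta_mx i j) = g i j.
  rewrite frob_innerE (bigD1 i) //= (bigD1 j) //= mxE !eqxx mulr1.
  rewrite [X in _ + X + _]big1 ?addr0; last first.
    by move=> k kj; rewrite mxE (negbTE kj) andbF mulr0.
  rewrite big1 ?addr0// => k ki; rewrite big1// => l _.
  by rewrite mxE (negbTE ki) mulr0.
apply: xget_unique => [H /=|g /= gP]; last first.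
  by apply/matrixP => i j; rewrite mxE gP inner_delta.
rewrite frob_innerE {1}(matrix_sum_delta H) linear_sum; apply: eq_bigr => i _.
rewrite linear_sum; apply: eq_bigr => j _.
by rewrite linearZ/= mxE mulrC.
Qed.

Lemma gradientP f A H : 'd f A H = frob_inner (gradient f A) H.
Proof.
rewrite gradientE frob_innerE {1}(matrix_sum_delta H) linear_sum.
apply: eq_bigr => i _; rewrite linear_sum; apply: eq_bigr => j _.
by rewrite linearZ/= mxE mulrC.
Qed.

Definition lipschitz_gradient (L : R) (f : 'M[R]_(r, d) -> R) : Prop :=
  forall A1 A2 : 'M[R]_(r, d),
    frob_norm (gradient f A1 - gradient f A2) <= L * frob_norm (A1 - A2).

End Frobenius.

Definition phi {R : realType} {m d r : nat} (F : 'M[R]_(m, d) -> R)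
  (B : 'M[R]_(m, r)) (A : 'M[R]_(r, d)) : R := F (B *m A).

(* Matrices with the Borel sigma-algebra of their usual topology. *)
Definition borel_mx (R : realType) (r d : nat) : Type :=
  g_sigma_algebraType (@open 'M[R]_(r, d)).

(* [is_cond_expectation P X Y Z]: [Z] is a version of E[Y | X], the conditional
   expectation of the real random variable [Y] given the sigma-algebra
   generated by [X]. *)
Definition is_cond_expectation {disp disp'} {Omega : measurableType disp}
    {S : measurableType disp'} {R : realType} (P : probability Omega R)
    (X : Omega -> S) (Y Z : Omega -> R) : Prop :=
  [/\ P.-integrable [set: Omega] (EFin \o Y),
      P.-integrable [set: Omega] (EFin \o Z),
      measurable_fun setT (Z : g_sigma_algebra_preimageType X -> R) &
      forall D : set Omega, g_sigma_algebra_preimage X D ->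
        (\int[P]_(w in D) (Z w)%:E = \int[P]_(w in D) (Y w)%:E)%E].

(* The bound E[ |G_t - grad|_F^2 | A_t ] <= sigma^2 is almost sure, for some
   (equivalently, every) version of the left-hand side; it entails that the
   squared error is integrable, so restricting to integrable variables in
   [is_cond_expectation] loses nothing. *)
Definition stochastic_gradient_descent {R : realType} {r d : nat}
    {disp} {Omega : measurableType disp} (P : probability Omega R)
    (f : 'M[R]_(r, d) -> R) (A0 : 'M[R]_(r, d)) (eta sigma : R)
    (A G : nat -> Omega -> 'M[R]_(r, d)) : Prop :=
  [/\ forall t, measurable_fun setT (A t : Omega -> borel_mx R r d) /\
                measurable_fun setT (G t : Omega -> borel_mx R r d),
      forall w, A 0%N w = A0,
      forall t w, A t.+1 w = A t w - eta *: G t w,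
      forall t i j,
        is_cond_expectation P (A t : Omega -> borel_mx R r d)
          (fun w => G t w i j) (fun w => gradient f (A t w) i j) &
      forall t, exists2 V : Omega -> R,
        is_cond_expectation P (A t : Omega -> borel_mx R r d)
          (fun w => frob_norm (G t w - gradient f (A t w)) ^+ 2) V &
        {ae P, forall w, V w <= sigma ^+ 2}].

(* For [0 < T] the neutral element [+oo] is irrelevant and this is the minimum
   of E[ |grad f (A_t)|_F^2 ] over [t < T]. *)
Definition min_expected_sq_gradient {R : realType} {r d : nat}
    {disp} {Omega : measurableType disp} (P : probability Omega R)
    (f : 'M[R]_(r, d) -> R) (A : nat -> Omega -> 'M[R]_(r, d)) (T : nat)
    : \bar R :=
  (\big[Order.min/+oo]_(t < T)
     'E_P[fun w => (frob_norm (gradient f (A t w)) ^+ 2)%R])%E.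

(* Main.v *)
(** A Lipschitz gradient gives the quadratic upper bound
    f(U + V) <= f(U) + <grad f(U), V> + L/2 |V|^2. With V = - eta (g_t + N_t),
    where g_t is the gradient at A_t and N_t = G_t - g_t the noise, its
    expectation reads
    E f(A_(t+1)) <= E f(A_t) - (eta - L eta^2 / 2) E|g_t|^2 + L eta^2 sigma^2 / 2,
    since E<g_t, N_t> = 0: g_t is measurable with respect to A_t and N_t has
    conditional mean 0 given A_t. As eta L <= 1, the coefficient of E|g_t|^2 is
    at least eta / 2, and summing over t < T telescopes. All these expectations
    are finite because, by induction on t, A_t, g_t and N_t are square
    integrable. *)
Require Import Defs.
From mathcomp Require Import all_boot all_order all_algebra.
From mathcomp Require Import all_classical all_reals all_analysis measurable_realfun.
From mathcomp Require Import ring lra.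
Set Implicit Arguments.
Unset Strict Implicit.
Unset Printing Implicit Defensive.
Import Order.TTheory GRing.Theory Num.Theory.
Import numFieldNormedType.Exports.
Local Open Scope classical_set_scope.
Local Open Scope ring_scope.

(** * Finite sums of integrable functions *)

Lemma integrable_EFin_sum {d} {T : measurableType d} {R : realType}
    (mu : {measure set T -> \bar R}) {I : Type} (s : seq I) (h : I -> T -> R) :
  (forall i, mu.-integrable setT (EFin \o h i)) ->
  mu.-integrable setT (EFin \o (fun x => \sum_(i <- s) h i x)).
Proof.
move=> ih; apply: (eq_integrable measurableT) => [x _|].
  by rewrite /= -sumEFin.
by apply: integrable_sum => // i _; exact: ih.
Qed.

Lemma Rintegral_sum {d} {T : measurableType d} {R : realType}
    (mu : {measure set T -> \bar R}) {I : Type} (s : seq I) (h : I -> T -> R) :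
  (forall i, mu.-integrable setT (EFin \o h i)) ->
  \int[mu]_x (\sum_(i <- s) h i x) = \sum_(i <- s) \int[mu]_x h i x.
Proof.
move=> ih; elim: s => [|i s IHs].
  rewrite big_nil; under eq_Rintegral do rewrite big_nil.
  by rewrite Rintegral_cst// mul0r.
under eq_Rintegral do rewrite big_cons.
rewrite RintegralD//; [by rewrite IHs big_cons|exact: integrable_EFin_sum].
Qed.

(** * Integrals against a factor with vanishing conditional mean *)

Section pull_out.
Context {d d'} {T : measurableType d} {S : measurableType d'} {R : realType}.
Variables (mu : {measure set T -> \bar R}) (X : T -> S) (N : T -> R).
Hypothesis mX : measurable_fun setT X.
Hypothesis iN : mu.-integrable setT (EFin \o N).
Hypothesis N0 : forall D, g_sigma_algebra_preimage X D ->
  \int[mu]_(x in D) N x = 0.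

Local Notation TX := (g_sigma_algebra_preimageType X).

Let subsigma D : g_sigma_algebra_preimage X D -> d.-measurable D.
Proof. by move=> [B mB <-]; exact: mX. Qed.

Let measurable_subsigma (Z : T -> R) :
  measurable_fun setT (Z : TX -> R) -> measurable_fun setT Z.
Proof. by move=> mZ _ B mB; apply: subsigma; exact: mZ. Qed.

Let indic_mulE D x : \1_D x * N x = (N \_ D) x.
Proof.
by rewrite indicE patchE; case: (x \in D); rewrite ?mul1r ?mul0r.
Qed.

Import HBNNSimple.

(** A simple function over [TX] is a finite combination of indicators of its level sets; these
    belong to the sigma-algebra of [X], so [N] integrates to zero over each by [N0]. *)
Let nnsfun_mul_integral0 (g : {nnsfun TX >-> R}) :
  \int[mu]_x (g x * N x) = 0.
Proof.
have gNE x : g x * N x =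
    \sum_(y <- finmap.enum_fset (fset_set (range g))) y * (N \_ (g @^-1` [set y])) x.
  rewrite fimfunE fsbig_finite; last exact: fimfunP.
  rewrite mulr_suml.
  by apply: eq_bigr => y _; rewrite -mulrA indic_mulE.
under eq_Rintegral do rewrite gNE.
have mg y : g_sigma_algebra_preimage X (g @^-1` [set y]).
  exact: (measurable_funPTI g (measurable_set1 y)).
have iNg y : mu.-integrable setT (EFin \o (N \_ (g @^-1` [set y]))).
  rewrite -restrict_EFin; apply/(integrable_mkcond _ (subsigma (mg y))).
  by apply: integrableS iN => //; exact: subsigma.
rewrite Rintegral_sum => [|y]; last first.
  apply: (eq_integrable measurableT) (integrableZl measurableT y (iNg y)) => x _.
  by rewrite /= EFinM.
apply: big1 => y _; rewrite RintegralZl//.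
by rewrite -Rintegral_mkcond N0 ?mulr0.
Qed.

(** Simple functions over [TX] increase to [Z], so their products with [N] are dominated by
    [|Z * N|], and dominated convergence passes the zero integrals to the limit. *)
Let ge0_mul_integral0 (Z : T -> R) : (forall x, 0 <= Z x) ->
  measurable_fun setT (Z : TX -> R) ->
  mu.-integrable setT (EFin \o (fun x => Z x * N x)) ->
  \int[mu]_x (Z x * N x) = 0.
Proof.
move=> Z0 mZ iZN.
have /measurable_EFinP mZE := mZ.
pose g := nnsfun_approx measurableT mZE.
have mN : measurable_fun setT N.
  by apply/measurable_EFinP; exact: measurable_int iN.
(* The approximants are measurable for the sigma-algebra of [X]; [gT] views them as functions on
   [T], where [mu] integrates. *)
pose gT n : T -> R := g n.
have mg n : measurable_fun setT (gT n).
  exact: (measurable_subsigma (measurable_funP (g n))).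
have mgN n : measurable_fun setT (EFin \o (fun x => gT n x * N x)).
  by apply/measurable_EFinP; exact: measurable_funM.
have Zg0 x : setT x -> (0 <= (EFin \o Z) x)%E by rewrite /= lee_fin.
have gZ n x : gT n x <= Z x.
  by rewrite /gT nnsfun_approxE -lee_fin; apply: le_approx.
have gcvg x : (fun n => gT n x) @ \oo --> Z x.
  by have /fine_cvgP[] := cvg_nnsfun_approx measurableT mZE Zg0 (x := x) I.
have gNcvg x : (fun n => (gT n x * N x)%:E) @ \oo --> (Z x * N x)%:E.
  by apply: cvg_EFin; [exact: nearW|exact: (cvgM (gcvg x) (cvg_cst _))].
have gNZN n x : (`|(gT n x * N x)%:E| <= `|(Z x * N x)%:E|)%E.
  by rewrite lee_fin !normrM ler_wpM2r// !ger0_norm// /gT.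
have igN n : mu.-integrable setT (EFin \o (fun x => gT n x * N x)).
  by apply: le_integrable iZN => // x _; exact: gNZN.
have [_ _ cvg_int] := @dominated_convergence _ _ _ mu setT measurableT
  (fun n => EFin \o (fun x => gT n x * N x)) (EFin \o (fun x => Z x * N x))
  (abse \o (EFin \o (fun x => Z x * N x))) mgN (measurable_int mu iZN)
  (aeW mu (fun x _ => gNcvg x))
  (integrable_abse iZN) (aeW mu (fun x n _ => gNZN n x)).
rewrite /Rintegral.
suff -> : (\int[mu]_x (Z x * N x)%:E = 0)%E by [].
have int0 n : (\int[mu]_x (gT n x * N x)%:E = 0)%E.
  have /fineK <- := integrable_fin_num measurableT (igN n).
  by congr EFin; exact: nnsfun_mul_integral0.
have /cvg_lim <- // := cvg_int.
by rewrite /=; under eq_fun do rewrite int0; exact: lim_cst.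
Qed.

(** Split [Z] into positive and negative parts: each is at most [|Z|], so its product with [N]
    inherits integrability from [Z * N]. *)
Lemma Rintegral_mul_eq0 (Z : T -> R) : measurable_fun setT (Z : TX -> R) ->
  mu.-integrable setT (EFin \o (fun x => Z x * N x)) ->
  \int[mu]_x (Z x * N x) = 0.
Proof.
move=> mZ iZN.
have mN : measurable_fun setT N.
  by apply/measurable_EFinP; exact: measurable_int iN.
have mZp := measurable_funrpos mZ.
have mZn := measurable_funrneg mZ.
have iZp : mu.-integrable setT (EFin \o (fun x => Z^\+ x * N x)).
  apply: le_integrable iZN => //.
    apply/measurable_EFinP/measurable_funM => //.
    exact: (measurable_subsigma mZp).
  move=> x _; rewrite lee_fin !normrM ler_wpM2r//.
  by rewrite ger0_norm// /funrpos ge_max ler_norm normr_ge0.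
have iZn : mu.-integrable setT (EFin \o (fun x => Z^\- x * N x)).
  apply: le_integrable iZN => //.
    apply/measurable_EFinP/measurable_funM => //.
    exact: (measurable_subsigma mZn).
  move=> x _; rewrite lee_fin !normrM ler_wpM2r//.
  by rewrite ger0_norm// /funrneg ge_max normr_ge0 andbT -(normrN (Z x)) ler_norm.
rewrite (@eq_Rintegral _ _ _ _ _ (fun x => Z^\+ x * N x - Z^\- x * N x)).
  by rewrite RintegralB// !ge0_mul_integral0 ?subr0.
by move=> x _ /=; rewrite -mulrBl -[in LHS](funrposBneg Z).
Qed.
End pull_out.

(** * The descent lemma *)

Section frobenius_theory.
Context {R : realType} {r d : nat}.
Implicit Types U V W : 'M[R]_(r, d).

Lemma frob_innerC U V : frob_inner U V = frob_inner V U.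
Proof.
rewrite !frob_innerE; apply: eq_bigr => i _; apply: eq_bigr => j _.
exact: mulrC.
Qed.

Lemma frob_innerDr U V W : frob_inner U (V + W) = frob_inner U V + frob_inner U W.
Proof. by rewrite /frob_inner mulmxDr mxtraceD. Qed.

Lemma frob_innerZr a U V : frob_inner U (a *: V) = a * frob_inner U V.
Proof. by rewrite /frob_inner -scalemxAr mxtraceZ. Qed.

Lemma frob_innerDl U V W : frob_inner (U + V) W = frob_inner U W + frob_inner V W.
Proof. by rewrite frob_innerC frob_innerDr !(frob_innerC W). Qed.

Lemma frob_innerZl a U V : frob_inner (a *: U) V = a * frob_inner U V.
Proof. by rewrite frob_innerC frob_innerZr frob_innerC. Qed.

Lemma frob_inner_ge0 U : 0 <= frob_inner U U.
Proof.
by rewrite frob_innerE; do 2 (apply: sumr_ge0 => ? _); rewrite -expr2 sqr_ge0.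
Qed.

Lemma sqr_frob_norm U : frob_norm U ^+ 2 = frob_inner U U.
Proof. by rewrite sqr_sqrtr ?frob_inner_ge0. Qed.

Lemma sqr_frob_normE U : frob_norm U ^+ 2 = \sum_i \sum_j U i j ^+ 2.
Proof. by rewrite sqr_frob_norm frob_innerE. Qed.

Lemma sqr_frob_normZ a U : frob_norm (a *: U) ^+ 2 = a ^+ 2 * frob_norm U ^+ 2.
Proof. by rewrite !sqr_frob_norm frob_innerZl frob_innerZr mulrA. Qed.

Lemma sqr_frob_normD U V : frob_norm (U + V) ^+ 2 =
  frob_norm U ^+ 2 + 2 * frob_inner U V + frob_norm V ^+ 2.
Proof.
rewrite !sqr_frob_norm !(frob_innerDl, frob_innerDr) (frob_innerC V U).
by ring.
Qed.

Lemma sqr_frob_normD_le U V :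
  frob_norm (U + V) ^+ 2 <= 2 * (frob_norm U ^+ 2 + frob_norm V ^+ 2).
Proof.
have := sqr_ge0 (frob_norm (U + -1 *: V)).
rewrite !sqr_frob_normD sqr_frob_normZ frob_innerZr; lra.
Qed.

Lemma sqr_frob_norm_le_sub U V :
  frob_norm U ^+ 2 <= 2 * (frob_norm (U - V) ^+ 2 + frob_norm V ^+ 2).
Proof. by rewrite -{1}(subrK V U) sqr_frob_normD_le. Qed.

Lemma sqr_coord_le_frob_norm U i j : U i j ^+ 2 <= frob_norm U ^+ 2.
Proof.
rewrite sqr_frob_normE (bigD1 i)//= (bigD1 j)//= -addrA lerDl addr_ge0//.
  by apply: sumr_ge0 => ? _; exact: sqr_ge0.
by do 2 (apply: sumr_ge0 => ? _); exact: sqr_ge0.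
Qed.

Section lipschitz.
Variables (f : 'M[R]_(r, d) -> R) (L : R).
Hypotheses (L_gt0 : 0 < L) (df : forall U, differentiable f U).
Hypothesis f_lip : lipschitz_gradient L f.

Lemma sqr_lipschitz_gradient U V :
  frob_norm (gradient f U - gradient f V) ^+ 2 <= L ^+ 2 * frob_norm (U - V) ^+ 2.
Proof. by rewrite -exprMn lerXn2r ?nnegrE ?mulr_ge0 ?sqrtr_ge0// ltW. Qed.

(* AM-GM in place of Cauchy-Schwarz. *)
Lemma lipschitz_gradient_inner U V (t : R) : 0 < t ->
  frob_inner (gradient f (U + t *: V)) V <=
  frob_inner (gradient f U) V + t * L * frob_norm V ^+ 2.
Proof.
move=> t0; have tL0 : 0 < t * L by rewrite mulr_gt0.
have W_le := sqr_lipschitz_gradient (U + t *: V) U.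
have UVU : U + t *: V - U = t *: V by rewrite addrC addKr.
rewrite UVU sqr_frob_normZ in W_le.
rewrite -[gradient f (U + _)](subrKC (gradient f U)) frob_innerDl lerD2l.
move: (gradient f (U + _) - _) W_le => W W_le.
(* Here [W] is the gradient increment, with [|W|^2 <= (t L)^2 |V|^2]. Expanding [|W - t L V|^2 >= 0]
   gives [2 t L <W, V> <= 2 (t L)^2 |V|^2]; then divide by [2 t L]. *)
have := sqr_ge0 (frob_norm (W + (- (t * L)) *: V)).
rewrite sqr_frob_normD frob_innerZr sqr_frob_normZ => W_ge; rewrite -(ler_pM2l tL0); lra.
Qed.

(** The difference quotient at [t] of the restriction to the line is the directional difference
    quotient of [f] at [U + t *: V] along [V]. *)
Lemma is_derive_line U V (t : R) :
  is_derive t (1 : R) (fun s : R => f (U + s *: V))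
    (frob_inner (gradient f (U + t *: V)) V).
Proof.
have quotE : (fun h : R => h^-1 *: (f (U + (h *: (1 : R) + t) *: V) - f (U + t *: V)))
    = (fun h : R => h^-1 *: (f (h *: V + (U + t *: V)) - f (U + t *: V))).
  apply/funext => h; congr (_ *: (f _ - _)).
  by rewrite scalerDl addrCA [h *: (1 : R)]mulr1.
split; first by rewrite /derivable quotE; exact: diff_derivable.
rewrite -gradientP -deriveE//.
by rewrite /derive quotE.
Qed.

(** The function [u] subtracts from [f] along the segment the linear and quadratic terms of the
    bound. By [lipschitz_gradient_inner] its derivative is nonpositive inside [[0, 1]], and the
    claim is [u 1 <= u 0]; no integral of the gradient is taken. *)
Lemma descent_lemma U V :
  f (U + V) <= f U + frob_inner (gradient f U) V + L / 2 * frob_norm V ^+ 2.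
Proof.
pose a := frob_inner (gradient f U) V; pose b := frob_norm V ^+ 2.
pose u (t : R) := f (U + t *: V) - t * a - t ^+ 2 * (L / 2 * b).
have du (t : R) : is_derive t (1 : R) u
    (frob_inner (gradient f (U + t *: V)) V - a - t * L * b).
  move: (frob_inner (gradient f (U + t *: V)) V) (is_derive_line U V t) => q df_t.
  apply: is_derive_eq; rewrite !scaler0 !scaler1 !add0r [_ *: (t + t)]mulrC.
  by move: a b {u} => a b; field.
have : u 1 <= u 0.
  apply: (@ler0_derive1_le_cc _ u 0 1) => //.
  - move=> x; rewrite in_itv/= => /andP[x0 x1].
    have [_ du_x] := du x.
    by rewrite derive1E du_x subr_le0 lerBlDl lipschitz_gradient_inner.
  - by apply: derivable_within_continuous => x _; have [] := du x.
  - by rewrite in_itv/= lexx ler01.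
  - by rewrite in_itv/= lexx ler01.
rewrite /u scale1r scale0r addr0; move: (f (U + V)) (f U) => p q.
rewrite -/a -/b; move: a b {u du} => a b ?; lra.
Qed.

End lipschitz.
End frobenius_theory.

(** * Square-integrable random matrices *)

Section square_integrable.
Context {d} {T : measurableType d} {R : realType}.
Variable mu : {measure set T -> \bar R}.
Local Notation integrable X := (mu.-integrable setT (EFin \o X)).

Lemma integrable_EFinD (X Y : T -> R) : integrable X -> integrable Y ->
  integrable (fun x => X x + Y x).
Proof.
by move=> iX iY; apply: eq_integrable (integrableD measurableT iX iY).
Qed.

Lemma integrable_EFinZ (a : R) (X : T -> R) : integrable X ->
  integrable (fun x => a * X x).
Proof.
by move=> iX; apply: eq_integrable (integrableZl measurableT a iX).
Qed.

Lemma le_integrable_EFin (X Y : T -> R) : measurable_fun setT X ->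
  (forall x, `|X x| <= Y x) -> integrable Y -> integrable X.
Proof.
move=> mX XY; apply: le_integrable => //; first exact/measurable_EFinP.
by move=> x _; rewrite lee_fin (le_trans (XY x))// ler_norm.
Qed.

(** Measurability is a separate clause because integrability of the square does not imply it. *)
Definition square_integrable (X : T -> R) :=
  measurable_fun setT X /\ integrable (fun x => X x ^+ 2).

Lemma le_square_integrable (X Y : T -> R) : measurable_fun setT X ->
  (forall x, X x ^+ 2 <= Y x) -> integrable Y -> square_integrable X.
Proof.
move=> mX XY iY; split=> //; apply: le_integrable_EFin iY.
  exact: measurable_funX.
by move=> x; rewrite ger0_norm ?sqr_ge0.
Qed.

Lemma square_integrableD (X Y : T -> R) :
  square_integrable X -> square_integrable Y ->
  square_integrable (fun x => X x + Y x).
Proof.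
move=> [mX iX] [mY iY].
apply: (@le_square_integrable _ (fun x => 2 * (X x ^+ 2 + Y x ^+ 2))).
- exact: measurable_funD.
- by move=> x; have := sqr_ge0 (X x - Y x); lra.
- exact/integrable_EFinZ/integrable_EFinD.
Qed.

Lemma square_integrableZ (a : R) (X : T -> R) :
  square_integrable X -> square_integrable (fun x => a * X x).
Proof.
move=> [mX iX]; apply: (@le_square_integrable _ (fun x => a ^+ 2 * X x ^+ 2)).
- exact: measurable_funM.
- by move=> x; rewrite exprMn.
- exact: integrable_EFinZ.
Qed.

Lemma integrable_mul (X Y : T -> R) :
  square_integrable X -> square_integrable Y -> integrable (fun x => X x * Y x).
Proof.
move=> [mX iX] [mY iY].
apply: (@le_integrable_EFin _ (fun x => X x ^+ 2 + Y x ^+ 2)).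
- exact: measurable_funM.
(* The squares of [X x - Y x] and [X x + Y x] bound the product from above and from below. *)
- move=> x; have := sqr_ge0 (X x - Y x); have := sqr_ge0 (X x + Y x).
  have := sqr_ge0 (X x); have := sqr_ge0 (Y x).
  by rewrite ler_norml => *; apply/andP; split; lra.
- exact: integrable_EFinD.
Qed.

Section matrices.
Context {r c : nat}.

Definition square_integrable_mx (M : T -> 'M[R]_(r, c)) :=
  forall i j, square_integrable (fun x => M x i j).

Lemma integrable_frob_inner (M N : T -> 'M[R]_(r, c)) :
  square_integrable_mx M -> square_integrable_mx N ->
  integrable (fun x => frob_inner (M x) (N x)).
Proof.
move=> iM iN; under eq_fun do rewrite frob_innerE.
by do 2! apply: integrable_EFin_sum => ?; exact: integrable_mul.
Qed.

Lemma integrable_sqr_frob_norm (M : T -> 'M[R]_(r, c)) :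
  square_integrable_mx M -> integrable (fun x => frob_norm (M x) ^+ 2).
Proof.
by move=> iM; under eq_fun do rewrite sqr_frob_norm; exact: integrable_frob_inner.
Qed.

Lemma le_square_integrable_mx (M : T -> 'M[R]_(r, c)) (Y : T -> R) :
  (forall i j, measurable_fun setT (fun x => M x i j)) ->
  (forall x, frob_norm (M x) ^+ 2 <= Y x) -> integrable Y ->
  square_integrable_mx M.
Proof.
move=> mM MY iY i j; apply: le_square_integrable iY => // x.
exact: le_trans (sqr_coord_le_frob_norm _ i j) (MY x).
Qed.

End matrices.
End square_integrable.

(** * Constants, Borel measurability and almost sure bounds *)

Lemma square_integrable_cst {d} {T : measurableType d} {R : realType}
  (mu : {finite_measure set T -> \bar R}) (a : R) : square_integrable mu (cst a).
Proof. by split; [|exact: (finite_measure_integrable_cst mu (a ^+ 2))]. Qed.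

(** Open rays generate the Borel sets of the line, and their preimages under a continuous function
    are open. *)
Lemma continuous_measurable_borel_mx {R : realType} {r d : nat}
    (f : 'M[R]_(r, d) -> R) :
  continuous f -> measurable_fun setT (f : borel_mx R r d -> R).
Proof.
move=> /continuousP cf; apply: (measurability _ (RGenOInfty.measurableE R)).
move=> _ [_ [x ->] <-]; apply: sub_sigma_algebra; rewrite setTI; apply: cf.
exact: interval_open.
Qed.

(** Monotonicity of the integral is applied pointwise, so [X] is first replaced by [X \min cst a],
    which equals it almost everywhere and is bounded by [a] everywhere; [P] has total mass 1. *)
Lemma ae_le_Rintegral_cst {d} {T : measurableType d} {R : realType}
    (P : probability T R) (X : T -> R) (a : R) :
  P.-integrable setT (EFin \o X) -> {ae P, forall x, X x <= a} ->
  \int[P]_x X x <= a.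
Proof.
move=> iX Xa; have mX := measurable_int _ iX.
have ia : P.-integrable setT (EFin \o cst a).
  exact: finite_measure_integrable_cst.
have mX' : measurable_fun setT X by exact/measurable_EFinP.
have XE : ae_eq P setT (EFin \o X) (EFin \o (X \min cst a)).
  by apply: filterS Xa => x Xa _ /=; rewrite (min_idPl Xa).
have mXa : measurable_fun setT (X \min cst a) by exact: measurable_minr.
have iXa : P.-integrable setT (EFin \o (X \min cst a)).
  apply: (le_integrable_EFin (Y := fun x => `|X x| + `|a|)) => // [x|].
    by rewrite /= minEle; case: ifP; rewrite ?lerDl ?lerDr.
  apply: (integrable_EFinD (X := fun x => `|X x|)).
    exact: (integrable_abse iX).
  exact: (finite_measure_integrable_cst P `|a|).
rewrite /Rintegral (ae_eq_integral _ _ measurableT mX (measurable_int _ iXa) XE).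
apply: (@le_trans _ _ (\int[P]_x cst a x)).
  by apply: le_Rintegral => // x _ /=; rewrite ge_min lexx orbT.
by rewrite Rintegral_cst// [X in fine X]probability_setT mulr1.
Qed.

(** * Stochastic gradient descent *)

Section sgd.
Context {R : realType} {r d : nat} {disp : measure_display}
  {Omega : measurableType disp}.
Variables (P : probability Omega R) (f : 'M[R]_(r, d) -> R) (L c : R)
  (A0 : 'M[R]_(r, d)) (eta sigma : R) (A G : nat -> Omega -> 'M[R]_(r, d)).
Hypotheses (L_gt0 : 0 < L) (df : forall U, differentiable f U)
  (f_lip : lipschitz_gradient L f) (f_ge : forall U, c <= f U)
  (sgd : stochastic_gradient_descent P f A0 eta sigma A G).
Local Notation integrable X := (P.-integrable setT (EFin \o X)).

Let g t w := gradient f (A t w).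
Let N t w := G t w - g t w.

Let A_succ t w : A t.+1 w = A t w + (- eta) *: (g t w + N t w).
Proof. by case: sgd => _ _ -> _ _; rewrite subrKC scaleNr. Qed.

Let integrable_g_coord t i j : integrable (fun w => g t w i j).
Proof. by case: sgd => _ _ _ /(_ t i j)[]. Qed.

Let integrable_G_coord t i j : integrable (fun w => G t w i j).
Proof. by case: sgd => _ _ _ /(_ t i j)[]. Qed.

Let NE t i j : (fun w => N t w i j) = (fun w => G t w i j + -1 * g t w i j).
Proof. by apply/funext => w; rewrite !mxE mulN1r. Qed.

Let integrable_N_coord t i j : integrable (fun w => N t w i j).
Proof. by rewrite NE; apply: integrable_EFinD => //; exact: integrable_EFinZ. Qed.

(** Unbiasedness in integrated form, the shape of the hypothesis [N0] of [Rintegral_mul_eq0]: [G]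
    and [g] have equal integrals over every event determined by [A t]. *)
Lemma Rintegral_noise_cond_eq0 t i j D :
  g_sigma_algebra_preimage (A t : Omega -> borel_mx R r d) D ->
  \int[P]_(w in D) N t w i j = 0.
Proof.
case: sgd => /(_ t)[mA _] _ _ /(_ t i j)[_ _ _ gG] _ AD.
have mD : measurable D by case: AD => B mB <-; exact: mA.
rewrite (@eq_Rintegral _ _ _ _ _ (fun w => G t w i j - g t w i j)); last first.
  by move=> w _; rewrite !mxE.
rewrite RintegralB//; [|exact: integrableS (integrable_G_coord t i j)
  |exact: integrableS (integrable_g_coord t i j)].
by rewrite /Rintegral gG// subrr.
Qed.

Lemma square_integrable_noise t : square_integrable_mx P (N t).
Proof.
case: sgd => _ _ _ _ /(_ t)[V [iN _ _ _] _].
apply: le_square_integrable_mx iN => // i j.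
exact/measurable_EFinP/measurable_int/integrable_N_coord.
Qed.

Lemma Rintegral_sqr_noise_le t :
  \int[P]_w frob_norm (N t w) ^+ 2 <= sigma ^+ 2.
Proof.
case: sgd => _ _ _ _ /(_ t)[V [_ iV _ VN] V_le].
rewrite /Rintegral -VN; first exact: ae_le_Rintegral_cst.
(* The whole space is an event of the sigma-algebra of [A t], so [V] and the squared noise have the
   same expectation. *)
by exists setT; rewrite // setTI.
Qed.

(** With [A0] as reference point, the Lipschitz condition bounds the gradient by a constant plus a
    multiple of the distance from [A t] to [A0]. *)
Lemma square_integrable_gradient t :
  square_integrable_mx P (A t) -> square_integrable_mx P (g t).
Proof.
move=> iA; apply: (@le_square_integrable_mx _ _ _ _ _ _ _
  (fun w => 2 * (L ^+ 2 * frob_norm (A t w + (- A0)) ^+ 2 +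
                 frob_norm (gradient f A0) ^+ 2))) => [i j|w|].
- exact/measurable_EFinP/measurable_int/integrable_g_coord.
- apply: le_trans (sqr_frob_norm_le_sub (g t w) (gradient f A0)) _.
  by rewrite ler_pM2l// lerD2r sqr_lipschitz_gradient.
- apply: integrable_EFinZ; apply: integrable_EFinD.
    apply/integrable_EFinZ/integrable_sqr_frob_norm => i j.
    under eq_fun do rewrite mxE.
    apply: square_integrableD; first exact: iA.
    exact: (square_integrable_cst P ((- A0) i j)).
  exact: (finite_measure_integrable_cst P).
Qed.

Lemma square_integrable_iterate t : square_integrable_mx P (A t).
Proof.
elim: t => [|t IHt] i j.
  case: sgd => _ A0E _ _ _; under eq_fun do rewrite A0E.
  exact: (square_integrable_cst P (A0 i j)).
under eq_fun do rewrite A_succ 3!mxE.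
apply: square_integrableD => //; apply: square_integrableZ.
apply: square_integrableD; first exact: square_integrable_gradient.
exact: square_integrable_noise.
Qed.

Let iN t := square_integrable_noise t.
Let ig t := square_integrable_gradient (square_integrable_iterate t).

Lemma Rintegral_inner_noise_eq0 t :
  \int[P]_w frob_inner (g t w) (N t w) = 0.
Proof.
case: sgd => /(_ t)[mA _] _ _ /(_ t) gG _.
under eq_Rintegral do rewrite frob_innerE.
have igN i j : integrable (fun w => g t w i j * N t w i j).
  by apply: integrable_mul; [exact: ig|exact: iN].
rewrite Rintegral_sum => [|i]; last exact: integrable_EFin_sum.
apply: big1 => i _; rewrite Rintegral_sum//; apply: big1 => j _.
(* Measurability of [g t] with respect to [A t] comes from the third clause of
   [is_cond_expectation]. *)
apply: (Rintegral_mul_eq0 mA) => //; last by case: (gG i j).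
exact: Rintegral_noise_cond_eq0.
Qed.

(** Right-hand side of [descent_lemma] for the increment [- eta (g + N)], grouped by [|g|^2],
    [<g, N>] and [|N|^2] so that it can be integrated term by term. *)
Let descent_bound t w := f (A t w) +
  (- (eta - L / 2 * eta ^+ 2) * frob_norm (g t w) ^+ 2 +
   ((L * eta ^+ 2 - eta) * frob_inner (g t w) (N t w) +
    L / 2 * eta ^+ 2 * frob_norm (N t w) ^+ 2)).

Let le_descent_bound t w : f (A t.+1 w) <= descent_bound t w.
Proof.
rewrite A_succ; apply: le_trans (descent_lemma L_gt0 df f_lip _ _) _.
rewrite sqr_frob_normZ frob_innerZr frob_innerDr sqr_frob_normD -sqr_frob_norm.
rewrite /descent_bound -/(g t w).
move: (f _) (frob_norm (g t w)) (frob_norm (N t w)) (frob_inner _ _) => p q s i.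
by rewrite le_eqVlt; apply/orP; left; apply/eqP; field.
Qed.

Lemma measurable_objective t : measurable_fun setT (f \o A t).
Proof.
case: sgd => /(_ t)[mA _] _ _ _ _.
apply: (measurableT_comp (continuous_measurable_borel_mx _) mA) => U.
exact: differentiable_continuous.
Qed.

Let integrable_descent_bound t :
  integrable (f \o A t) -> integrable (descent_bound t).
Proof.
move=> ifA; apply: integrable_EFinD => //; apply: integrable_EFinD.
  exact/integrable_EFinZ/integrable_sqr_frob_norm.
apply: integrable_EFinD; first exact/integrable_EFinZ/integrable_frob_inner.
exact/integrable_EFinZ/integrable_sqr_frob_norm.
Qed.

(** By induction: [f (A t.+1 w)] lies between [c] and [descent_bound t w], which is integrable once
    [f \o A t] is. *)
Lemma integrable_objective t : integrable (f \o A t).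
Proof.
elim: t => [|t IHt].
  case: sgd => _ A0E _ _ _.
  have -> : f \o A 0%N = cst (f A0) by apply/funext => w; rewrite /= A0E.
  exact: finite_measure_integrable_cst.
apply: (le_integrable_EFin (Y := fun w => `|descent_bound t w| + `|c|)).
- exact: measurable_objective.
- move=> w; have := le_descent_bound t w; have := f_ge (A t.+1 w).
  have := ler_norm (descent_bound t w); have := normr_ge0 (descent_bound t w).
  have := ler_norm (- c); have := normr_ge0 c; rewrite normrN /=.
  move: (f _) (descent_bound t w) => y z.
  by rewrite ler_norml => *; apply/andP; split; lra.
- apply: (integrable_EFinD (X := fun w => `|descent_bound t w|)).
    exact: (integrable_abse (integrable_descent_bound IHt)).
  exact: (finite_measure_integrable_cst P `|c|).
Qed.

(** * Expected descent in one step, and telescoping *)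

Hypotheses (eta_gt0 : 0 < eta) (eta_le : eta <= L^-1).

Lemma Rintegral_objective_succ_le t :
  eta / 2 * \int[P]_w frob_norm (g t w) ^+ 2 <=
  \int[P]_w f (A t w) - \int[P]_w f (A t.+1 w) + L / 2 * eta ^+ 2 * sigma ^+ 2.
Proof.
have ifA := integrable_objective t.
have ig2 := integrable_sqr_frob_norm (ig t).
have igN := integrable_frob_inner (ig t) (iN t).
have iN2 := integrable_sqr_frob_norm (iN t).
have : \int[P]_w f (A t.+1 w) <= \int[P]_w descent_bound t w.
  apply: le_Rintegral => //; first exact: integrable_objective.
  exact: integrable_descent_bound.
rewrite RintegralD//; last first.
  by apply/integrable_EFinD; [|apply/integrable_EFinD]; exact/integrable_EFinZ.
rewrite RintegralD//; [|exact: integrable_EFinZ|]; last first.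
  by apply/integrable_EFinD; exact/integrable_EFinZ.
rewrite RintegralD//; [|exact: integrable_EFinZ..].
rewrite !RintegralZl// Rintegral_inner_noise_eq0 mulr0 add0r.
have := Rintegral_sqr_noise_le t.
have : 0 <= \int[P]_w frob_norm (g t w) ^+ 2.
  by apply: Rintegral_ge0 => w _; exact: sqr_ge0.
move: (\int[P]_w frob_norm (g t w) ^+ 2) (\int[P]_w frob_norm (N t w) ^+ 2).
move: (\int[P]_w f (A t w)) (\int[P]_w f (A t.+1 w)) => p p' q s q0 s_le H.
have etaL : eta * L <= 1 by rewrite -ler_pdivlMr// div1r.
have h1 : L / 2 * eta ^+ 2 * s <= L / 2 * eta ^+ 2 * sigma ^+ 2.
  by rewrite ler_wpM2l// mulr_ge0 ?sqr_ge0// divr_ge0// ltW.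
(* The quadratic term [L / 2 * eta ^+ 2 * q] is thus at most [eta / 2 * q], leaving half of the
   decrease [eta * q]. *)
have h2 : eta * (eta * L) * q <= eta * q.
  by rewrite ler_wpM2r// ler_piMr// ltW.
lra.
Qed.

Lemma sum_Rintegral_sqr_gradient_le T :
  eta / 2 * \sum_(t < T) \int[P]_w frob_norm (g t w) ^+ 2 <=
  f A0 - c + T%:R * (L / 2 * eta ^+ 2 * sigma ^+ 2).
Proof.
(* The induction keeps the expectation of [f (A T w)], so that the sum telescopes; the lower bound
   [c] enters only afterwards. *)
have le_T : eta / 2 * \sum_(t < T) \int[P]_w frob_norm (g t w) ^+ 2 <=
    f A0 - \int[P]_w f (A T w) + T%:R * (L / 2 * eta ^+ 2 * sigma ^+ 2).
  elim: T => [|T IHT].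
    rewrite big_ord0 mulr0 mul0r addr0.
    case: sgd => _ A0E _ _ _; under eq_Rintegral do rewrite A0E.
    by rewrite Rintegral_cst// [X in fine X]probability_setT mulr1 subrr.
  rewrite big_ord_recr mulrDr -[T.+1%:R]natr1 mulrDl mul1r.
  by have := Rintegral_objective_succ_le T; lra.
apply: le_trans le_T _; rewrite lerD2r lerD2l lerN2.
have <- : \int[P]_w cst c w = c.
  by rewrite Rintegral_cst// [X in fine X]probability_setT mulr1.
apply: le_Rintegral => //; last exact: integrable_objective.
exact: finite_measure_integrable_cst.
Qed.

Lemma sgd_min_expected_sq_gradient_le T : (1 <= T)%N ->
  (min_expected_sq_gradient P f A T <=
   (2 * (f A0 - c) / (eta * T%:R) + L * eta * sigma ^+ 2)%:E)%E.
Proof.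
move=> T_ge1; set b := _ + _.
have T_gt0 : 0 < T%:R :> R by rewrite ltr0n.
(* Otherwise all [T] expectations exceed [b], contradicting the summed bound, whose right-hand side
   is exactly [eta / 2] times [T] copies of [b]. *)
have [t qt_le] : exists t : 'I_T, \int[P]_w frob_norm (g t w) ^+ 2 <= b.
  apply/not_existsP => q_gt.
  have := sum_Rintegral_sqr_gradient_le T; apply/negP; rewrite -ltNge.
  have -> : f A0 - c + T%:R * (L / 2 * eta ^+ 2 * sigma ^+ 2) =
      eta / 2 * \sum_(t < T) b.
    rewrite sumr_const card_ord -mulr_natr /b; field.
    by rewrite !gt_eqF.
  rewrite ltr_pM2l ?divr_gt0//; apply: ltr_sum => [|t _].
    (* Strictness of the summed inequality requires a nonempty index set, which [T_ge1] provides. *)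
    by apply/hasP; exists (Ordinal T_ge1); rewrite ?mem_index_enum.
  by rewrite ltNge; apply/negP; exact: q_gt.
apply: (bigmin_inf t) => //; rewrite unlock.
(* The expectation is an extended real; it is finite by square integrability of the gradient, so it
   can be compared through its real value. *)
rewrite -[leLHS]fineK ?lee_fin//.
exact: (integrable_fin_num measurableT (integrable_sqr_frob_norm (ig t))).
Qed.

End sgd.

(** * The bound for the factored objective and the resulting rate *)

Theorem theorem3 (R : realType) (m d r : nat)
  (m_ge1 : (1 <= m)%N) (d_ge1 : (1 <= d)%N) (r_ge1 : (1 <= r)%N)
  (F : 'M[R]_(m, d) -> R)
  (smooth : forall B : 'M[R]_(m, r),
     (forall A : 'M[R]_(r, d), differentiable (phi F B) A) /\
     exists2 L : R, 0 < L & lipschitz_gradient L (phi F B : 'M[R]_(r, d) -> R))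
  (bounded : forall B : 'M[R]_(m, r),
     exists c : R, forall A : 'M[R]_(r, d), c <= phi F B A)
  (B : 'M[R]_(m, r)) (LA phi_inf : R)
  (LA_gt0 : 0 < LA)
  (LA_lip : lipschitz_gradient LA (phi F B : 'M[R]_(r, d) -> R))
  (phi_infP : forall A : 'M[R]_(r, d), phi_inf <= phi F B A)
  (sigma : R) (sigma_ge0 : 0 <= sigma) (A0 : 'M[R]_(r, d)) :
  (forall (eta : R), 0 < eta -> eta <= LA^-1 ->
     forall (disp : measure_display) (Omega : measurableType disp)
       (P : probability Omega R) (A G : nat -> Omega -> 'M[R]_(r, d)),
     stochastic_gradient_descent P (phi F B) A0 eta sigma A G ->
     forall T : nat, (1 <= T)%N ->
     (min_expected_sq_gradient P (phi F B) A T <=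
        (2 * (phi F B A0 - phi_inf) / (eta * T%:R)
         + LA * eta * sigma ^+ 2)%:E)%E)
  /\
  (forall c1 c2 : R, 0 < c1 -> c1 <= c2 ->
     exists C : R, forall T : nat, (1 <= T)%N ->
     forall eta : R,
     c1 * T%:R `^ (- 2^-1) <= eta -> eta <= c2 * T%:R `^ (- 2^-1) ->
     eta <= LA^-1 ->
     forall (disp : measure_display) (Omega : measurableType disp)
       (P : probability Omega R) (A G : nat -> Omega -> 'M[R]_(r, d)),
     stochastic_gradient_descent P (phi F B) A0 eta sigma A G ->
     (min_expected_sq_gradient P (phi F B) A T <=
        (C * T%:R `^ (- 2^-1))%:E)%E).
Proof.
have [df _] := smooth B.
split=> [eta eta_gt0 eta_le disp Omega P A G sgd T T_ge1|c1 c2 c1_gt0 c1_le].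
  exact: (sgd_min_expected_sq_gradient_le LA_gt0 df LA_lip phi_infP sgd).
(* With [s] the power [T^(-1/2)], [eta >= c1 s] gives [1 / (eta T) <= s / c1], and [eta <= c2 s]
   bounds the noise term; both are then multiples of [s]. *)
exists (2 * (phi F B A0 - phi_inf) / c1 + LA * c2 * sigma ^+ 2).
move=> T T_ge1 eta eta_ge eta_le_c2 eta_le disp Omega P A G sgd.
have T_gt0 : 0 < T%:R :> R by rewrite ltr0n.
pose s : R := T%:R `^ (- 2^-1); rewrite -/s in eta_ge eta_le_c2 *.
have s_gt0 : 0 < s by rewrite powR_gt0.
have sT : T%:R^-1 = s * s.
  rewrite /s -powRD; last by rewrite (gt_eqF T_gt0) implybT.
  have -> : - 2^-1 - 2^-1 = -1 :> R by field.
  by rewrite powR_inv1 ?ler0n.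
have eta_gt0 : 0 < eta by apply: lt_le_trans eta_ge; rewrite mulr_gt0.
apply: le_trans (sgd_min_expected_sq_gradient_le LA_gt0 df LA_lip phi_infP sgd
  eta_gt0 eta_le T_ge1) _.
rewrite lee_fin [leRHS]mulrDl lerD//.
  rewrite invfM sT -[leRHS]mulrA.
  (* The initial gap is nonnegative by [phi_infP] at [A0], so it remains to compare its
     coefficients. *)
  apply: ler_wpM2l; first by rewrite mulr_ge0// subr_ge0.
  rewrite mulrA ler_pM2r// ler_pdivrMl// ler_pdivlMr//.
  by rewrite mulrC.
rewrite [leRHS](_ : _ = LA * (c2 * s) * sigma ^+ 2); last by ring.
by rewrite ler_wpM2r ?sqr_ge0// ler_pM2l.
Qed.
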